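(* Let $F:\mathbb{R}^n\times\mathbb{R}\times\mathbb{R}^n\times\mathcal{S}^n\to\mathbb{R}$ satisfy: (i) (degenerate ellipticity) $F(x,u,p,X)\ge F(x,v,p,Y)$ whenever $x,p\in\mathbb{R}^n$, $u\ge v$ and $X\le Y$; (ii) $-F(x,0,p,X)\le \phi(|p|)-\mathcal{P}^-_{\lambda,\Lambda}(X)$ for all $x,p\in\mathbb{R}^n$, $X\in\mathcal{S}^n$, where $0<\lambda\le\Lambda$ and $\phi:[0,\infty)\to[0,\infty)$ is a strictly increasing continuous function with $\phi(t)\ge t$ for all $t\geq 0$ such that (iii) for every sufficiently small $\epsilon>0$, $\int_0^\epsilon f_\nu(t)\,dt\to\infty$ as $\nu\to\infty$, where $f_\nu$ solves $f_\nu'(t)=-\phi(f_\nu(t))$ with $f_\nu(0)=\nu$. Let $\Omega\subset\mathbb{R}^n$ be a domain satisfying the exterior ball condition with radius $r_e$, let $w\in\partial\Omega$ and let $r$ satisfy $0<2r<r_e$. Assume that $u$ is a strictly positive viscosity subsolution of $F(x,u,Du,D^2u)=0$ in $\Omega\cap B(w,6r)$, upper semicontinuous on $\overline\Omega\cap B(w,6r)$, satisfying $u=0$ on $\partial\Omega\cap B(w,6r)$ and with $\sup_{B(w,6r)\cap\Omega}u<\infty$. Then there exists a constant $c\geq 1$, depending only on $\lambda,\Lambda,n,\phi,r_e$ and $r^{-1}\sup_{B(w,6r)\cap\Omega}u$, such that $$u(x)\le c\,d(x,\partial\Omega)\qquad\text{for all }x\in\Omega\cap B(w,r).$$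
   Context: A domain is an open connected set; $B(x,r)$ is the open ball; $d(x,E)$ is the Euclidean distance from $x$ to $E$. $\Omega$ satisfies the exterior ball condition with radius $r_e>0$ if for every $w\in\partial\Omega$ there is $\eta^e\in\mathbb{R}^n\setminus\Omega$ with $B(\eta^e,r_e)\subset\mathbb{R}^n\setminus\Omega$ and $\partial B(\eta^e,r_e)\cap\partial\Omega=\{w\}$. $\mathcal{S}^n$ is the set of symmetric $n\times n$ real matrices with the positive semi-definite ordering. For $X\in\mathcal{S}^n$ with eigenvalues $e_1,\dots,e_n$, $\mathcal{P}^-_{\lambda,\Lambda}(X):=-\Lambda\sum_{e_i\ge0}e_i-\lambda\sum_{e_i<0}e_i$. An upper semicontinuous function $u:U\to\mathbb{R}$ on an open set $U$ is a viscosity subsolution of $F(x,u,Du,D^2u)=0$ in $U$ if for every $\varphi\in C^2(U)$ and every $x_0\in U$ at which $u-\varphi$ has a local maximum, $F(x_0,u(x_0),D\varphi(x_0),D^2\varphi(x_0))\le0$. *)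

(* Defs.v *)
From HB Require Import structures.
From mathcomp Require Import all_boot all_order all_algebra.
From mathcomp Require Import all_classical all_reals all_analysis.

Set Implicit Arguments.
Unset Strict Implicit.
Unset Printing Implicit Defensive.

Import Order.TTheory GRing.Theory Num.Theory.
Import numFieldNormedType.Exports.

Local Open Scope classical_set_scope.
Local Open Scope ring_scope.

(* The library norm on 'rV[R]_n is the sup norm: it induces the usual topology,
   but balls and distances have to be taken with respect to [enorm]. *)
Definition enorm (R : realType) (n : nat) (x : 'rV[R]_n) : R :=
  Num.sqrt (\sum_(i < n) x ord0 i ^+ 2).

Definition eball (R : realType) (n : nat) (x : 'rV[R]_n) (r : R) :
    set 'rV[R]_n :=
  [set y | enorm (y - x) < r].

Definition set_dist (R : realType) (n : nat) (x : 'rV[R]_n) (E : set 'rV[R]_n) : R :=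
  inf [set enorm (x - y) | y in E].

Definition boundary (T : topologicalType) (A : set T) : set T :=
  closure A `\` interior A.

Definition domain (T : topologicalType) (A : set T) : Prop :=
  open A /\ connected A.

Definition exterior_ball (R : realType) (n : nat) (Omega : set 'rV[R]_n)
    (re : R) : Prop :=
  forall w, boundary Omega w ->
    exists eta : 'rV[R]_n,
      [/\ (~` Omega) eta,
          eball eta re `<=` ~` Omega &
          boundary (eball eta re) `&` boundary Omega = [set w]].

Definition symmetric_mx (R : realType) (n : nat) (X : 'M[R]_n) : Prop :=
  X^T = X.

Definition psd_le (R : realType) (n : nat) (X Y : 'M[R]_n) : Prop :=
  forall v : 'rV[R]_n, 0 <= (v *m (Y - X) *m v^T) ord0 ord0.

(* Eigenvalues listed with multiplicity. For symmetric X such a list exists and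
   is unique up to permutation; [::] is a junk value when there is none. *)
Definition eigenvalues (R : realType) (n : nat) (X : 'M[R]_n) : seq R :=
  xget [::] [set s : seq R | char_poly X = \prod_(e <- s) ('X - e%:P)].

Definition pucci_minus (R : realType) (n : nat) (lam Lam : R) (X : 'M[R]_n) : R :=
  - Lam * (\sum_(e <- eigenvalues X | 0 <= e) e)
  - lam * (\sum_(e <- eigenvalues X | e < 0) e).

Definition partial (R : realType) (n : nat) (i : 'I_n) (f : 'rV[R]_n -> R) :
    'rV[R]_n -> R :=
  fun x => 'D_(delta_mx ord0 i) f x.

Definition grad (R : realType) (n : nat) (f : 'rV[R]_n -> R) (x : 'rV[R]_n) :
    'rV[R]_n :=
  \row_(i < n) partial i f x.

Definition hess (R : realType) (n : nat) (f : 'rV[R]_n -> R) (x : 'rV[R]_n) :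
    'M[R]_n :=
  \matrix_(i < n, j < n) partial i (partial j f) x.

(* Meant for open U, so that only the values of f on U matter. *)
Definition C2 (R : realType) (n : nat) (U : set 'rV[R]_n) (f : 'rV[R]_n -> R) :
    Prop :=
  forall x, U x ->
    [/\ {for x, continuous f},
        forall i : 'I_n,
          derivable f x (delta_mx ord0 i) /\ {for x, continuous (partial i f)} &
        forall i j : 'I_n,
          derivable (partial j f) x (delta_mx ord0 i) /\
          {for x, continuous (partial i (partial j f))}].

Definition usc_on (R : realType) (T : topologicalType) (A : set T) (u : T -> R) :
    Prop :=
  forall x, A x -> forall a : R, u x < a ->
    \forall y \near within A (nbhs x), u y < a.

Definition local_max_in (R : realType) (T : topologicalType) (U : set T)
    (g : T -> R) (x0 : T) : Prop :=
  U x0 /\ \forall y \near within U (nbhs x0), g y <= g x0.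

(* F is evaluated at symmetric matrices only: the Hessian of a C^2 function. *)
Definition viscosity_subsolution (R : realType) (n : nat)
    (F : 'rV[R]_n -> R -> 'rV[R]_n -> 'M[R]_n -> R)
    (U : set 'rV[R]_n) (u : 'rV[R]_n -> R) : Prop :=
  usc_on U u /\
  forall f : 'rV[R]_n -> R, C2 U f ->
    forall x0, local_max_in U (fun x => u x - f x) x0 ->
      F x0 (u x0) (grad f x0) (hess f x0) <= 0.

Definition degenerate_elliptic (R : realType) (n : nat)
    (F : 'rV[R]_n -> R -> 'rV[R]_n -> 'M[R]_n -> R) : Prop :=
  forall (x : 'rV[R]_n) (u v : R) (p : 'rV[R]_n) (X Y : 'M[R]_n),
    symmetric_mx X -> symmetric_mx Y -> v <= u -> psd_le X Y ->
    F x v p Y <= F x u p X.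

(* f' = - phi(f), f(0) = nu on [0, e]. The sign constraint says that f stays in
   [0, +oo[, where phi is defined. *)
Definition decay_solution (R : realType) (phi : R -> R) (nu e : R) (f : R -> R) :
    Prop :=
  [/\ f 0 = nu,
      forall t : R, 0 <= t <= e -> 0 <= f t,
      {within `[0, e], continuous f} &
      forall t : R, 0 < t < e -> is_derive t 1 f (- phi (f t))].

(* Forward solutions are unique because phi is increasing. If phi 0 > 0, the
   solution starting at nu leaves [0, +oo[ in finite time, but at a time that
   increases with nu: hence the order of the two [near] quantifiers. *)
Definition divergent_decay (R : realType) (phi : R -> R) : Prop :=
  exists f : R -> R -> R,
    \forall e \near 0^'+,
      (\forall nu \near +oo, decay_solution phi nu e (f nu)) /\
      (\int[lebesgue_measure]_(t in `[0, e]) f nu t @[nu --> +oo] --> +oo).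

(* Main.v *)
(* Near a boundary point w' take an exterior ball of radius r and centre eta
   touching at w', and compare u with the radial function
     v(y) = r / (4 K) * G (K (|y - eta|^2 - r^2) / r^2),
   where G' = f_nu. Since f_nu' = - phi f_nu, the radial eigenvalue of D^2 v is
   at most - (K - 1) phi(f_nu) / r, while the other eigenvalues are at most
   phi(f_nu) / r and |Dv| is at most f_nu; a K depending only on lam, Lam, n and
   re then makes v a strict supersolution. As the integral of f_nu diverges, some nu,
   depending on M but not on r, makes v at least M r on the outer sphere, so
   u <= v by comparison at a maximum of u - v, and v grows at most linearly in
   the distance to w'. *)

Require Import Defs.
From HB Require Import structures.
From mathcomp Require Import all_boot all_order all_algebra.
From mathcomp Require Import all_classical all_reals all_analysis.
From mathcomp Require Import ring lra.

Import Order.TTheory GRing.Theory Num.Theory.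
Import numFieldNormedType.Exports.

Local Open Scope classical_set_scope.
Local Open Scope ring_scope.

(** * The Pucci operator at a scalar matrix plus a rank-one matrix *)

(** Multiplying the block matrix [N] by [P] or by [Q] makes it block triangular; comparing the
    determinants gives the identity times [c], which cancels. An integral domain is general enough
    for the polynomial [c = 'X - a]. *)
Lemma det_scalar_sub_rank1 (A : idomainType) (m : nat) (c : A)
    (u : 'cV[A]_m.+1) (v : 'rV[A]_m.+1) : c != 0 ->
  \det (c%:M - u *m v) = c ^+ m * (c - (v *m u) ord0 ord0).
Proof.
move=> c0.
pose N := block_mx c%:M u v 1%:M : 'M[A]_(m.+1 + 1).
pose P := block_mx 1%:M 0 (- v) 1%:M : 'M[A]_(m.+1 + 1).
pose Q := block_mx 1%:M 0 (- v) c%:M : 'M[A]_(m.+1 + 1).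
have NP : N *m P = block_mx (c%:M - u *m v) u 0 1%:M.
  by rewrite mulmx_block !mulmx1 !mulmx0 mul1mx mulmxN add0r subrr add0r.
have QN : Q *m N = block_mx c%:M u 0 (c%:M - v *m u).
  rewrite mulmx_block !mul1mx !mul0mx !addr0 mulmx1 !mulNmx.
  by rewrite mul_mx_scalar mul_scalar_mx addNr addrC.
have := congr1 determinant NP; have := congr1 determinant QN.
rewrite !det_mulmx !det_ublock !det_lblock !det1 !mulr1 !mul1r.
rewrite !det_scalar det_mx11 !mxE expr1 => dQN <-.
by apply: (mulfI c0); rewrite dQN exprS mulrA.
Qed.

Lemma char_poly_scalar_add_rank1 (K : fieldType) (m : nat) (a b : K)
    (z : 'rV[K]_m.+1) :
  char_poly (a%:M + b *: (z^T *m z)) =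
  \prod_(e <- (a + b * \sum_i z ord0 i ^+ 2) :: nseq m a) ('X - e%:P).
Proof.
rewrite /char_poly /char_poly_mx.
set u := map_mx polyC (b *: z^T); set v := map_mx polyC z.
have -> : 'X%:M - map_mx polyC (a%:M + b *: (z^T *m z)) =
    ('X - a%:P)%:M - u *m v.
  rewrite -map_mxM -scalemxAl raddfD /= map_scalar_mx opprD addrA.
  by congr (_ - _); rewrite -raddfB.
rewrite det_scalar_sub_rank1 ?polyXsubC_eq0//.
rewrite big_cons big_nseq iter_mulr_1 mulrC; congr (_ * _).
rewrite -map_mxM mxE polyCD opprD addrA; congr (_ - _%:P).
rewrite mxE mulr_sumr; apply: eq_bigr => i _.
by rewrite !mxE; ring.
Qed.

(** The two sign conditions put the [m] eigenvalues orthogonal to [z] in the first sum of the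
    operator and the one along [z] in the second. *)
Lemma pucci_minus_scalar_add_rank1 (R : realType) (m : nat) (lam Lam a b : R)
    (z : 'rV[R]_m.+1) : 0 <= a -> a + b * \sum_i z ord0 i ^+ 2 < 0 ->
  pucci_minus lam Lam (a%:M + b *: (z^T *m z)) =
  - Lam * (a *+ m) - lam * (a + b * \sum_i z ord0 i ^+ 2).
Proof.
set e := a + _ => a0 e0; rewrite /pucci_minus.
set X := a%:M + _.
have Xe := char_poly_scalar_add_rank1 _ _ a b z; rewrite -/X -/e in Xe.
(* The list picked by [xget] is arbitrary, but unique factorization makes it a permutation of the
   explicit one. *)
have /(@prod_XsubC_eq _ _ _) pe : \prod_(x <- eigenvalues X) ('X - x%:P) =
    \prod_(x <- e :: nseq m a) ('X - x%:P).
  rewrite -Xe /eigenvalues; symmetry.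
  exact: (@xgetPex _ [::] [set s : seq R | char_poly X = \prod_(x <- s) ('X - x%:P)]
    (ex_intro _ _ Xe)).
rewrite !(perm_big _ pe) /= !big_cons leNgt e0 /= !big_nseq_cond.
by rewrite a0 ltNge a0 /= iter_addr_0 addr0.
Qed.

(** * Derivatives of radial functions *)

Definition sqnorm (R : realType) (n : nat) (x : 'rV[R]_n) : R :=
  \sum_(i < n) x ord0 i ^+ 2.

Arguments sqnorm {R n} x.

Section Radial.
Variables (R : realType) (n : nat) (eta : 'rV[R]_n).

Lemma sqnorm_ge0 (x : 'rV[R]_n) : 0 <= sqnorm x.
Proof. by apply: sumr_ge0 => i _; exact: sqr_ge0. Qed.

Lemma is_derive_coord (i : 'I_n) (x v : 'rV[R]_n) :
  is_derive x v (fun y : 'rV[R]_n => y ord0 i) (v ord0 i).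
Proof.
apply: DeriveDef; first exact/diff_derivable/differentiable_coord.
have /(congr1 (fun A : 'rV[R]_n => A ord0 i)) := derive_mx (@derivable_id _ _ x v).
by rewrite derive_id mxE /= => ->.
Qed.

(** The chain rule for a radial function needs full differentiability here, not just directional
    derivatives. *)
Lemma differentiable_sqdist (x : 'rV[R]_n) :
  differentiable (fun y : 'rV[R]_n => sqnorm (y - eta)) x.
Proof.
rewrite (_ : (fun _ => _) =
    \sum_(i < n) ((fun y : 'rV[R]_n => y ord0 i) - cst (eta ord0 i)) ^+ 2).
  apply: differentiable_sum => i; apply: differentiableX.
  by apply: differentiableB; [exact: differentiable_coord|exact: differentiable_cst].
apply/funext => y; rewrite fct_sumE /sqnorm; apply: eq_bigr => i _.
by rewrite !mxE.
Qed.

Lemma is_derive_sqdist (x v : 'rV[R]_n) :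
  is_derive x v (fun y : 'rV[R]_n => sqnorm (y - eta))
    (\sum_(i < n) 2 * (x - eta) ord0 i * v ord0 i).
Proof.
rewrite (_ : (fun _ => _) =
    \sum_(i < n) ((fun y : 'rV[R]_n => y ord0 i) - cst (eta ord0 i)) ^+ 2).
  apply: is_derive_sum => i; have := is_derive_coord i x v => ?.
  apply: is_derive_eq.
  by rewrite subr0 /= expr1 !mxE.
apply/funext => y; rewrite fct_sumE /sqnorm; apply: eq_bigr => i _.
by rewrite !mxE.
Qed.

Lemma is_derive_radial (psi : R -> R) (dpsi : R) (i : 'I_n) (x : 'rV[R]_n) :
  is_derive (sqnorm (x - eta)) 1 psi dpsi ->
  is_derive x (delta_mx ord0 i) (fun y => psi (sqnorm (y - eta)))
    (dpsi * (2 * (x - eta) ord0 i)).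
Proof.
move=> [dv de]; have dq := differentiable_sqdist x.
have dp := (derivable1_diffP _ _).1 dv.
apply: DeriveDef; first exact/diff_derivable/differentiable_comp.
rewrite deriveE; last exact: differentiable_comp.
rewrite diff_comp// deriv1E //= -deriveE// derive1E de.
have [_ ->] := is_derive_sqdist x (delta_mx ord0 i).
rewrite (bigD1 i)//= big1 ?addr0 => [|j ji].
  by rewrite [delta_mx _ _ _ _]mxE !eqxx mulr1 [LHS]mulrC.
by rewrite [delta_mx _ _ _ _]mxE eqxx (negbTE ji) mulr0.
Qed.

Variables psi psi1 psi2 : R -> R.
(** Only values of a squared distance matter, hence [0 <= s]; the derivative at 0 is two-sided, so
    [psi] has to extend below 0. *)
Hypothesis dpsi : forall s : R, 0 <= s -> is_derive s 1 psi (psi1 s).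
Hypothesis dpsi1 : forall s : R, 0 <= s -> is_derive s 1 psi1 (psi2 s).
Hypothesis cpsi2 : forall s : R, 0 <= s -> {for s, continuous psi2}.

Let radial := fun y : 'rV[R]_n => psi (sqnorm (y - eta)).

Lemma partial_radial (i : 'I_n) :
  partial i radial =
  (fun y => psi1 (sqnorm (y - eta)) * (2 * (y - eta) ord0 i)).
Proof.
apply/funext => y; rewrite /partial.
by have [] := is_derive_radial _ _ i y (dpsi _ (sqnorm_ge0 (y - eta))).
Qed.

Lemma is_derive_partial_radial (i j : 'I_n) (x : 'rV[R]_n) :
  is_derive x (delta_mx ord0 i) (partial j radial)
   ((2 * psi1 (sqnorm (x - eta)))%:M i j +
    4 * psi2 (sqnorm (x - eta)) * ((x - eta) ord0 i * (x - eta) ord0 j)).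
Proof.
rewrite partial_radial.
rewrite (_ : (fun _ => _) = (fun y => psi1 (sqnorm (y - eta))) *
    (2 \*: ((fun y : 'rV[R]_n => y ord0 j) - cst (eta ord0 j)))); last first.
  by apply/funext => y /=; rewrite !mxE.
have ? := is_derive_radial _ _ i x (dpsi1 _ (sqnorm_ge0 (x - eta))).
have ? := is_derive_coord j x (delta_mx ord0 i).
apply: is_derive_eq.
rewrite /= !mxE eqxx subr0 /= (eq_sym j).
by rewrite /GRing.scale /= !fctE /GRing.scale /=; case: (i == j) => /=; ring.
Qed.

Lemma C2_radial (U : set 'rV[R]_n) : C2 U radial.
Proof.
have cq : continuous (fun y : 'rV[R]_n => sqnorm (y - eta)).
  by move=> x; apply: differentiable_continuous; exact: differentiable_sqdist.
have cc i : continuous (fun y : 'rV[R]_n => (y - eta) ord0 i).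
  move=> x; rewrite (_ : (fun _ => _) =
    (fun y : 'rV[R]_n => y ord0 i) \- cst (eta ord0 i)); last first.
    by apply/funext => y; rewrite !mxE.
  by apply: continuousB; [exact: coord_continuous|exact: cst_continuous].
have cpsi (f f1 : R -> R) (x : 'rV[R]_n) :
    (forall s : R, 0 <= s -> is_derive s 1 f (f1 s)) ->
    {for x, continuous (fun y : 'rV[R]_n => f (sqnorm (y - eta)))}.
  move=> df; apply: (continuous_comp (cq x)).
  apply: differentiable_continuous; apply/derivable1_diffP.
  by have [] := df _ (sqnorm_ge0 (x - eta)).
move=> x _; split; first exact: cpsi.
- move=> i; split; first by
    have [] := is_derive_radial _ _ i x (dpsi _ (sqnorm_ge0 (x - eta))).
  rewrite partial_radial; apply: continuousM; first exact: cpsi.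
  by apply: continuousM; [exact: cst_continuous|exact: cc].
- move=> i j; split; first by have [] := is_derive_partial_radial i j x.
  rewrite (_ : partial i _ = (fun y =>
    2 * psi1 (sqnorm (y - eta)) * (i == j)%:R +
    4 * psi2 (sqnorm (y - eta)) * ((y - eta) ord0 i * (y - eta) ord0 j))).
    have c4 (k : R) : {for x, continuous (fun _ : 'rV[R]_n => k)}.
      exact: cst_continuous.
    apply: continuousD.
      by apply: continuousM => //; apply: continuousM => //; exact: cpsi.
    apply: continuousM; last by apply: continuousM; exact: cc.
    apply: continuousM => //.
    by apply: (continuous_comp (cq x)); exact: cpsi2 (sqnorm_ge0 _).
  apply/funext => y; rewrite {1}/partial.
  have [_ ->] := is_derive_partial_radial i j y.
  by rewrite [X in X + _]mxE -[X in X + _]mulr_natr.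
Qed.

Lemma grad_radial (x : 'rV[R]_n) :
  grad radial x = (2 * psi1 (sqnorm (x - eta))) *: (x - eta).
Proof. by apply/rowP => i; rewrite !mxE partial_radial !mxE; ring. Qed.

(** This is the scalar plus rank-one shape treated above: the tangential eigenvalue is [2 * psi1],
    and the radial one adds [4 * psi2] times the squared distance. *)
Lemma hess_radial (x : 'rV[R]_n) :
  hess radial x = (2 * psi1 (sqnorm (x - eta)))%:M +
    (4 * psi2 (sqnorm (x - eta))) *: ((x - eta)^T *m (x - eta)).
Proof.
apply/matrixP => i j; rewrite !mxE {1}/partial.
have [_ ->] := is_derive_partial_radial i j x.
by rewrite big_ord1 !mxE.
Qed.

End Radial.

(** * The one-variable profile built from the decay equation *)

Lemma continuous_comp_within (T U V : topologicalType) (A : set U)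
    (f : U -> V) (c : T -> U) : {within A, continuous f} -> continuous c ->
  (forall t, A (c t)) -> continuous (f \o c).
Proof.
move=> /subspace_continuousP cf cc Ac x.
apply: cvg_comp; last exact: cf (Ac x).
move=> P /cc; rewrite /nbhs /=; apply: filterS => t; exact.
Qed.

(** The fundamental theorem is applied on [[a, t + 1]], where [t] is an interior point; hence the
    strict [a < t]. *)
Lemma antiderivative (R : realType) (a : R) (h : R -> R) :
  (forall t, a <= t -> {for t, continuous h}) ->
  exists H : R -> R, forall t : R, a < t -> is_derive t 1 H (h t).
Proof.
move=> ch; exists (fun x => \int[lebesgue_measure]_(t in `[a, x]) h t)%R => t at_.
have tu : t < t + 1 by rewrite ltrDl.
have ih : lebesgue_measure.-integrable `[a, t + 1] (EFin \o h).
  apply: continuous_compact_integrable; first exact: segment_compact.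
  apply: continuous_in_subspaceT => x; rewrite inE /= in_itv /= => /andP[ax _].
  exact: ch.
have [dH H'] := continuous_FTC1_closed tu ih at_ (ch t (ltW at_)).
by rewrite derive1E in H'; exact: DeriveDef dH H'.
Qed.

Lemma is_derive_continuous (R : realType) (f : R -> R) (t df : R) :
  is_derive t 1 f df -> {for t, continuous f}.
Proof.
by move=> [d _]; apply/differentiable_continuous/derivable1_diffP.
Qed.

Section Profile.
Variables (R : realType) (phi : R -> R).
Hypothesis phi_ge0 : forall t : R, 0 <= t -> 0 <= phi t.
Hypothesis phi_cont : {within `[0, +oo[, continuous phi}.

(** On [[0, e']], [g] is [f] and [G] its integral, which reaches [B] at [e']. The negative [a]
    leaves room for the arguments that the barrier takes inside the exterior ball. *)
Lemma barrier_profile (nu e B a : R) (f : R -> R) :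
  decay_solution phi nu e f -> 0 < e -> 0 < B -> a < 0 ->
  B < \int[lebesgue_measure]_(t in `[0, e]) f t ->
  exists (e' : R) (G g h : R -> R),
    [/\ 0 < e' <= e,
        forall t : R, a < t -> is_derive t 1 G (g t) /\ is_derive t 1 g (h t),
        continuous h,
        G 0 = 0 /\ G e' = B &
        forall t : R, 0 <= t <= e' ->
          [/\ 0 < g t <= nu, h t = - phi (g t) & 0 <= G t <= nu * t]].
Proof.
move=> [f0 f_ge0 fcont df] e0 B0 a0 Bint.
pose clamp (t : R) := Num.max 0 (Num.min t e).
have clampP t : 0 <= clamp t <= e.
  by rewrite /clamp le_max lexx ge_max ge_min lexx orbT (ltW e0).
have clampE t : 0 <= t <= e -> clamp t = t.
  by rewrite /clamp => /andP[t0 te]; rewrite min_l// max_r.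
have cclamp : continuous clamp.
  move=> x; apply: (@continuous_max R R (cst 0) (fun t => Num.min t e)).
    exact: cst_continuous.
  apply: (@continuous_min R R id (cst e)); first by move=> ?; exact: cvg_id.
  exact: cst_continuous.
have cfc : continuous (f \o clamp).
  apply: continuous_comp_within fcont cclamp _ => t /=.
  by rewrite in_itv /= clampP.
(* f solves the equation on ]0, e[ only; freezing it outside [0, e] gives a
   primitive that is C^2 on a whole half-line. *)
pose h t := - phi (f (clamp t)).
have ch : continuous h.
  have cphi : continuous (phi \o (f \o clamp)).
    apply: continuous_comp_within phi_cont cfc _ => t /=.
    by rewrite in_itv /= andbT f_ge0.
  by move=> x; apply: continuousN; exact: cphi.
have h_le0 t : h t <= 0 by rewrite /h oppr_le0 phi_ge0// f_ge0.
(* Starting at [a - 1] makes [g] continuous at [a] too, so that it can be integrated again from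
   [a]. *)
have [g0 dg0] := antiderivative R (a - 1) h (fun t _ => ch t).
pose g t := g0 t - g0 0 + nu.
have dg t : a - 1 < t -> is_derive t 1 g (h t).
  move=> /dg0 dgt.
  rewrite (_ : g = g0 - cst (g0 0) + cst nu); last by apply/funext.
  by apply: is_derive_eq; rewrite subr0 addr0.
have cg t : a - 1 < t -> {for t, continuous g}.
  by move=> /dg; exact: is_derive_continuous.
have cgw x y : a <= x -> {within `[x, y], continuous g}.
  move=> ax; apply: continuous_in_subspaceT => z.
  rewrite inE /= in_itv /= => /andP[xz _]; apply: cg.
  by rewrite (lt_le_trans _ (le_trans ax xz))// ltrBlDr ltrDl.
have g_anti x y : a <= x -> x <= y -> g y <= g x.
  move=> ax xy; have [|c _ E] := @MVT_segment R g h x y xy _ (cgw _ _ ax).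
    move=> z; rewrite in_itv /= => /andP[xz _]; apply: dg.
    by rewrite (lt_trans _ (le_lt_trans ax xz))// ltrBlDr ltrDl.
  by rewrite -subr_le0 E mulr_le0_ge0// subr_ge0.
(* On [[0, e]] both functions start at [nu] and have the same derivative, since [clamp] is the
   identity there. *)
have gf t : 0 <= t <= e -> g t = f t.
  move=> /andP[t0 te].
  have [||c _] := @MVT_segment R (g - f) (fun=> 0) 0 t t0.
  - move=> z; rewrite in_itv /= => /andP[z0 zt].
    have dgz : is_derive z 1 g (h z).
      by apply: dg; rewrite (lt_trans _ z0)// subr_lt0 (lt_trans a0).
    have ze : z < e := lt_le_trans zt te.
    have dfz : is_derive z 1 f (- phi (f z)) by apply: df; rewrite z0.
    apply: is_derive_eq; rewrite /h clampE ?subrr//.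
    by rewrite (ltW z0) (ltW ze).
  - apply: within_continuousB; first by apply: cgw; exact: ltW.
    apply: continuous_subspaceW fcont; apply: subset_itvl.
    by rewrite bnd_simp.
  rewrite mul0r !fctE f0 {2}/g subrr add0r subrr subr0 => /eqP.
  by rewrite subr_eq0 => /eqP.
have [G0 dG0] : exists G, forall t : R, a < t -> is_derive t 1 G (g t).
  apply: antiderivative => t at_; apply: cg.
  by rewrite (lt_le_trans _ at_)// ltrBlDr ltrDl.
pose G t := G0 t - G0 0.
have dG t : a < t -> is_derive t 1 G (g t).
  move=> /dG0 dgt.
  rewrite (_ : G = G0 - cst (G0 0)); last by apply/funext.
  by apply: is_derive_eq; rewrite subr0.
have cG t : a < t -> {for t, continuous G}.
  by move=> /dG; exact: is_derive_continuous.
have cGw x y : 0 <= x -> {within `[x, y], continuous G}.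
  move=> ax; apply: continuous_in_subspaceT => z.
  rewrite inE /= in_itv /= => /andP[xz _]; apply: cG.
  exact: lt_le_trans a0 (le_trans ax xz).
have GE0 : G 0 = 0 by rewrite /G subrr.
have BGe : B < G e.
  apply: (lt_le_trans Bint); have <- : G e - G 0 = G e by rewrite GE0 subr0.
  rewrite (_ : \int[_]_(t in _) _ = \int[lebesgue_measure]_(t in `[0, e]) g t)%R.
    rewrite /Rintegral (@continuous_FTC2 R g G 0 e)//.
    - by apply: cgw; exact: ltW.
    - split.
      + move=> x; rewrite in_itv /= => /andP[x0 _].
        by have [] := dG x (lt_trans a0 x0).
      + by apply: cvg_at_right_filter; exact: cG.
      + by apply: cvg_at_left_filter; apply: cG; exact: lt_trans e0.
    - move=> x; rewrite in_itv /= => /andP[x0 _]; rewrite derive1E.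
      by have [] := dG x (lt_trans a0 x0).
  by apply: eq_Rintegral => x; rewrite inE /= in_itv /= => /gf.
(* f may vanish before e, where the barrier would not be strict; stopping when
   the integral reaches B keeps g positive. *)
have [e' e'_in Ge'] : exists2 c, c \in `[0, e] & G c = B.
  apply: IVT; [exact: ltW|exact: cGw|].
  by rewrite GE0 ge_min (ltW B0) le_max (ltW BGe) orbT.
move: e'_in; rewrite in_itv /= => /andP[e'0 e'e].
have e'_gt0 : 0 < e'.
  rewrite lt_def e'0 andbT; apply/eqP => e'E.
  by move: B0; rewrite -Ge' e'E GE0 ltxx.
(* Otherwise the nonincreasing [g] is nonpositive after [e'], so that [G e <= G e' = B], against
   [B < G e]. *)
have ge'0 : 0 < g e'.
  rewrite ltNge; apply/negP => ge'.
  have [|c] := @MVT_segment R G g e' e e'e _ (cGw _ _ e'0).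
    move=> z; rewrite in_itv /= => /andP[xz _].
    exact/dG/(lt_trans a0)/(le_lt_trans e'0).
  rewrite in_itv /= => /andP[e'c _] E.
  have : G e - G e' <= 0.
    rewrite E mulr_le0_ge0 ?subr_ge0//; apply: le_trans ge'; apply: g_anti => //.
    exact: le_trans (ltW a0) e'0.
  by rewrite Ge' subr_le0 leNgt BGe.
exists e', G, g, h; split => //; first by rewrite e'_gt0.
  by move=> t at_; split; [exact: dG|apply: dg; rewrite ltrBlDr (lt_trans at_)// ltrDl].
have g_bnd t : 0 <= t <= e' -> 0 < g t <= nu.
  move=> /andP[t0 te']; apply/andP; split.
    by apply: lt_le_trans ge'0 _; apply: g_anti => //; exact: le_trans (ltW a0) t0.
  have -> : nu = g 0 by rewrite /g subrr add0r.
  by apply: g_anti => //; exact: ltW.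
move=> t t_in; have /andP[t0 te'] := t_in.
have te : 0 <= t <= e by rewrite t0 (le_trans te').
split; [exact: g_bnd|by rewrite /h clampE// gf|].
have [|c] := @MVT_segment R G g 0 t t0 _ (cGw _ _ (lexx _)).
  by move=> z; rewrite in_itv /= => /andP[z0 _]; exact/dG/(lt_trans a0).
rewrite in_itv /= GE0 !subr0 => /andP[c0 ct] ->.
have /g_bnd/andP[gc gnu] : 0 <= c <= e' by rewrite c0 (le_trans ct).
by rewrite mulr_ge0 ?(ltW gc)//= ler_wpM2r.
Qed.

End Profile.

(** * Maxima of upper semicontinuous functions *)

(** The superlevel sets [up z] are nested and generate a proper filter, which clusters at some [x].
    If [g x < g z], then [g] stays below [g z] near [x], where [up z] still has points. *)
Lemma usc_compact_max (R : realType) (T : topologicalType) (A : set T)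
    (g : T -> R) : compact A -> A !=set0 -> usc_on A g ->
  exists2 x, A x & forall z, A z -> g z <= g x.
Proof.
move=> cA [a Aa] ug.
pose up z := [set y | A y /\ g z <= g y].
have PF : ProperFilter (filter_from A up).
  apply: filter_from_proper; last by move=> z Az; exists z; split.
  apply: filter_from_filter; first by exists a.
  move=> y z Ay Az; have [yz|zy] := leP (g y) (g z).
    by exists z => // t [At zt]; do 2!split => //; exact: le_trans zt.
  by exists y => // t [At yt]; do 2!split => //; apply: le_trans yt; exact: ltW.
have [|x [Ax clx]] := cA _ PF; first by exists a => // y [].
exists x => // z Az; rewrite leNgt; apply/negP => xz.
have [|y [[Ay zy]]] := clx (up z) _ _ (ug x Ax _ xz); first by exists z.
by move=> /(_ Ay); rewrite ltNge zy.
Qed.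

(** * The Euclidean norm and exterior balls *)

Section EuclideanNorm.
Variables (R : realType) (n : nat).
Implicit Types x y : 'rV[R]_n.

Lemma enorm_sqnorm x : enorm x ^+ 2 = sqnorm x.
Proof. by rewrite sqr_sqrtr ?sqnorm_ge0. Qed.

Lemma enorm_ge0 x : 0 <= enorm x.
Proof. exact: sqrtr_ge0. Qed.

Lemma sqnormZ (c : R) x : sqnorm (c *: x) = c ^+ 2 * sqnorm x.
Proof.
by rewrite /sqnorm mulr_sumr; apply: eq_bigr => i _; rewrite mxE exprMn.
Qed.

Lemma enormZ (c : R) x : enorm (c *: x) = `|c| * enorm x.
Proof.
rewrite /enorm -/(sqnorm (c *: x)) sqnormZ sqrtrM ?sqr_ge0//.
by rewrite sqrtr_sqr.
Qed.

Lemma enormN x : enorm (- x) = enorm x.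
Proof. by rewrite -scaleN1r enormZ normrN1 mul1r. Qed.

Lemma enormB x y : enorm (x - y) = enorm (y - x).
Proof. by rewrite -opprB enormN. Qed.

Lemma enorm0_eq0 x : enorm x = 0 -> x = 0.
Proof.
move=> x0; have : sqnorm x = 0 by rewrite -enorm_sqnorm x0 expr0n.
move=> /eqP; rewrite psumr_eq0 => [|i _]; last exact: sqr_ge0.
by move=> /allP xi; apply/rowP => i; rewrite mxE;
  have := xi i (mem_index_enum i); rewrite sqrf_eq0 => /eqP.
Qed.

Lemma normr_coord_le_enorm x (i : 'I_n) : `|x ord0 i| <= enorm x.
Proof.
rewrite -sqrtr_sqr ler_wsqrtr// (bigD1 i)//= lerDl.
by apply: sumr_ge0 => j _; exact: sqr_ge0.
Qed.

(** Cauchy-Schwarz, by expanding the squared norm of [enorm y *: x - enorm x *: y] and dividing by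
    the product of the norms when it is nonzero. *)
Lemma dot_le_enorm x y : \sum_i x ord0 i * y ord0 i <= enorm x * enorm y.
Proof.
have [/eqP x0|x0] := boolP (enorm x == 0).
  rewrite x0 (enorm0_eq0 _ x0) mul0r big1// => i _.
  by rewrite mxE mul0r.
have [/eqP y0|y0] := boolP (enorm y == 0).
  rewrite y0 (enorm0_eq0 _ y0) mulr0 big1// => i _.
  by rewrite mxE mulr0.
have xy0 : 0 < enorm x * enorm y by rewrite mulr_gt0// lt_def enorm_ge0 ?x0 ?y0.
have : 0 <= sqnorm (enorm y *: x - enorm x *: y) by exact: sqnorm_ge0.
have -> : sqnorm (enorm y *: x - enorm x *: y) =
    2 * (enorm x * enorm y) * (enorm x * enorm y - \sum_i x ord0 i * y ord0 i).
  have -> : 2 * (enorm x * enorm y) * (enorm x * enorm y -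
      \sum_i x ord0 i * y ord0 i) = enorm y ^+ 2 * enorm x ^+ 2 +
      enorm x ^+ 2 * enorm y ^+ 2 -
      2 * (enorm x * enorm y) * \sum_i x ord0 i * y ord0 i by ring.
  rewrite {1}(enorm_sqnorm x) {2}(enorm_sqnorm y) /sqnorm !mulr_sumr.
  rewrite -big_split /= -sumrB; apply: eq_bigr => i _.
  by rewrite !mxE; ring.
by rewrite pmulr_rge0 ?subr_ge0// mulr_gt0.
Qed.

Lemma enormD x y : enorm (x + y) <= enorm x + enorm y.
Proof.
rewrite -(@ler_pXn2r _ 2)// ?nnegrE ?addr_ge0 ?enorm_ge0//.
rewrite sqrrD !enorm_sqnorm.
have -> : sqnorm (x + y) =
    sqnorm x + (\sum_i x ord0 i * y ord0 i) *+ 2 + sqnorm y.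
  rewrite /sqnorm -sumrMnl -!big_split /=; apply: eq_bigr => i _.
  by rewrite !mxE; ring.
by rewrite lerD2r lerD2l lerMn2r dot_le_enorm orbT.
Qed.

(** Boundedness refers to the sup norm, so the compactness of Euclidean balls passes through this
    comparison. *)
Lemma normr_le_enorm x : `|x| <= enorm x.
Proof.
rewrite [leLHS]/Num.Def.normr/= mx_normrE.
apply: bigmax_le => [|[i j] _ /=]; first exact: enorm_ge0.
by rewrite (ord1 i); exact: normr_coord_le_enorm.
Qed.

Lemma continuous_sqdist (eta : 'rV[R]_n) :
  continuous (fun y : 'rV[R]_n => sqnorm (y - eta)).
Proof.
by move=> x; apply: differentiable_continuous; exact: differentiable_sqdist.
Qed.

Lemma closed_sqdist_le (eta : 'rV[R]_n) (c : R) :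
  closed [set y | sqnorm (y - eta) <= c].
Proof.
apply: (@preimage_closed _ _ (fun y => sqnorm (y - eta)) [set t | t <= c]).
  by move=> y _; exact: continuous_sqdist.
exact: closed_le.
Qed.

Lemma closed_sqdist_ge (eta : 'rV[R]_n) (c : R) :
  closed [set y | c <= sqnorm (y - eta)].
Proof.
apply: (@preimage_closed _ _ (fun y => sqnorm (y - eta)) [set t | c <= t]).
  by move=> y _; exact: continuous_sqdist.
exact: closed_ge.
Qed.

Lemma compact_closed_sqdist_le (A : set 'rV[R]_n) (eta : 'rV[R]_n) (c : R) :
  closed A -> compact (A `&` [set y | sqnorm (y - eta) <= c]).
Proof.
move=> clA; apply: bounded_closed_compact; last first.
  by apply: closedI => //; exact: closed_sqdist_le.
exists (Num.sqrt c + `|eta|); split; first exact: num_real.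
move=> M /ltW cM y [_ /= yc]; apply: le_trans cM.
rewrite -[y in leLHS](subrK eta) (le_trans (ler_normD _ _))// lerD2r.
by rewrite (le_trans (normr_le_enorm _))// ler_wsqrtr.
Qed.

(** A smaller ball internally tangent at [w] to the given exterior ball lies inside it, hence also
    outside [Omega]. *)
Lemma exterior_ball_shrink (Omega : set 'rV[R]_n) (re r : R) (w : 'rV[R]_n) :
  exterior_ball Omega re -> boundary Omega w -> 0 < r -> r <= re ->
  exists2 eta : 'rV[R]_n, enorm (w - eta) = r &
    forall y, Omega y -> r <= enorm (y - eta).
Proof.
move=> ext bw r0 rre; have re0 := lt_le_trans r0 rre.
have [eta [_ sub bdry]] := ext w bw.
have [[clw nintw] _] : (boundary (eball eta re) `&` boundary Omega) w.
  by rewrite bdry.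
have open_ball : open (eball eta re).
  rewrite (_ : eball _ _ = ~` [set y | re ^+ 2 <= sqnorm (y - eta)]).
    by rewrite openC; exact: closed_sqdist_ge.
  apply/seteqP; split => y /=.
    move=> yr; apply/negP; rewrite -ltNge -enorm_sqnorm.
    by rewrite ltr_pXn2r ?nnegrE ?enorm_ge0// ltW.
  move=> /negP; rewrite -ltNge -enorm_sqnorm.
  by rewrite ltr_pXn2r ?nnegrE ?enorm_ge0// ltW.
(* As a limit of points of the ball, [w] is at distance at most [re]; a smaller distance would put
   it in the interior of the open ball. *)
have wre : enorm (w - eta) = re.
  apply/eqP; rewrite eq_le; apply/andP; split.
    have : closure [set y | sqnorm (y - eta) <= re ^+ 2] w.
      apply: closure_subset clw => y /= yr; rewrite -enorm_sqnorm.
      by rewrite ler_pXn2r ?nnegrE ?enorm_ge0 ?ltW.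
    rewrite -(closure_id _).1; last exact: closed_sqdist_le.
    by rewrite /= -enorm_sqnorm ler_pXn2r ?nnegrE ?enorm_ge0// ltW.
  rewrite leNgt; apply/negP => wr; apply: nintw.
  by rewrite (interior_id _).1.
exists (w + (r / re) *: (eta - w)).
  rewrite opprD addNKr enormN enormZ enormB wre gtr0_norm ?divr_gt0//.
  by rewrite divfK// gt_eqF.
move=> y Oy; rewrite leNgt; apply/negP => yr.
apply: (sub y) => //; rewrite /eball /=.
(* The detour through the new centre costs [re - r], the distance between the centres. *)
rewrite (_ : y - eta = (y - (w + (r / re) *: (eta - w))) +
    (1 - r / re) *: (w - eta)); last by apply/rowP => i; rewrite !mxE; ring.
apply: le_lt_trans (enormD _ _) _; rewrite enormZ wre.
rewrite ger0_norm ?subr_ge0 ?ler_pdivrMr ?mul1r//.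
rewrite mulrBl mul1r divfK ?gt_eqF//; lra.
Qed.

End EuclideanNorm.

(** * The barrier and the comparison argument *)

Section Barrier.
Variables (R : realType) (m : nat) (lam Lam : R) (phi : R -> R).
Hypothesis lam_gt0 : 0 < lam.
Hypothesis Lam_gt0 : 0 < Lam.
Hypothesis phi_incr : forall s t : R, 0 <= s -> s < t -> phi s < phi t.
Hypothesis phi_ge_id : forall t : R, 0 <= t -> t <= phi t.
Variables (r K : R).
Hypothesis r_gt0 : 0 < r.
Hypothesis K_ge1 : 1 <= K.
Hypothesis lamK_gt : r + Lam * m%:R + lam < lam * K.
Variables (e nu : R) (G g h : R -> R).
Hypothesis e_le1 : e <= 1.
Hypothesis dGg : forall t : R, - K - 1 < t ->
  is_derive t 1 G (g t) /\ is_derive t 1 g (h t).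
Hypothesis ch : continuous h.
Hypothesis profile : forall t : R, 0 <= t <= e ->
  [/\ 0 < g t <= nu, h t = - phi (g t) & 0 <= G t <= nu * t].
Variable eta : 'rV[R]_m.+1.

(** [tau] vanishes on the sphere of radius [r] and equals [- K] at the centre, hence the half-line
    in [dGg]. [psi1] and [psi2] are the first two derivatives of [psi]. *)
Let tau (s : R) := K / r ^+ 2 * s - K.
Let psi (s : R) := r / (4 * K) * G (tau s).
Let psi1 (s : R) := (4 * r)^-1 * g (tau s).
Let psi2 (s : R) := K / (4 * r ^+ 3) * h (tau s).

(* A function of the squared distance, hence C^2 everywhere, including at [eta];
   the factor [r / (4 K)] makes its gradient at most [g] in norm where the
   distance to [eta] is at most [2 r], which is what [phi (enorm p)] requires as
   nothing bounds [phi (k * t)] by a multiple of [phi t]. *)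
Definition barrier (y : 'rV[R]_m.+1) : R := psi (sqnorm (y - eta)).

Let K_gt0 : 0 < K. Proof. exact: lt_le_trans ltr01 K_ge1. Qed.

Let tau_gt (s : R) : 0 <= s -> - K - 1 < tau s.
Proof.
move=> s0; rewrite /tau; have : 0 <= K / r ^+ 2 * s.
  by rewrite !mulr_ge0 ?invr_ge0 ?sqr_ge0// ltW.
lra.
Qed.

Let dtau (s : R) : is_derive s 1 tau (K / r ^+ 2).
Proof.
rewrite (_ : tau = (K / r ^+ 2) *: (@id R) - cst K); last by apply/funext.
by apply: is_derive_eq; rewrite subr0 [LHS]mulr1.
Qed.

Let dcomp (f : R -> R) (c k s d : R) : is_derive (tau s) 1 f d ->
  c * (K / r ^+ 2) * d = k -> is_derive s 1 (fun t => c * f (tau t)) k.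
Proof.
move=> df <-; have dt := dtau s.
have dc : is_derive s 1 (f \o tau) (d * (K / r ^+ 2)) by exact: is_derive1_comp.
rewrite (_ : (fun _ => _) = c *: (f \o tau)); last by apply/funext.
by apply: is_derive_eq; rewrite -mulrA [d * _]mulrC.
Qed.

Let r_neq0 : r != 0. Proof. by rewrite gt_eqF. Qed.
Let K_neq0 : K != 0. Proof. by rewrite gt_eqF. Qed.

Let dpsi (s : R) : 0 <= s -> is_derive s 1 psi (psi1 s).
Proof.
move=> /tau_gt /dGg[dG _]; apply: dcomp dG _.
by rewrite /psi1; field; rewrite r_neq0 K_neq0.
Qed.

Let dpsi1 (s : R) : 0 <= s -> is_derive s 1 psi1 (psi2 s).
Proof.
move=> /tau_gt /dGg[_ dg]; apply: dcomp dg _.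
by rewrite /psi2; field; rewrite r_neq0.
Qed.

Let cpsi2 (s : R) : 0 <= s -> {for s, continuous psi2}.
Proof.
move=> _; apply: continuousM; first exact: cst_continuous.
apply: (@continuous_comp _ _ _ tau h); last exact: ch.
exact: is_derive_continuous (dtau s).
Qed.

Let tauE (s : R) : tau s = K * ((s - r ^+ 2) / r ^+ 2).
Proof. by rewrite /tau; field; rewrite r_neq0. Qed.

Let tau_in (s : R) : r ^+ 2 <= s <= r ^+ 2 * (1 + e / K) -> 0 <= tau s <= e.
Proof.
move=> /andP[s_ge s_le]; have r2 : 0 < r ^+ 2 by rewrite exprn_gt0.
rewrite tauE mulr_ge0 ?divr_ge0 ?subr_ge0//; [|exact: ltW|exact: ltW].
rewrite -ler_pdivlMl// ler_pdivrMr//; move: s_le.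
by rewrite mulrDr mulr1 -lerBlDl mulrC (mulrC e).
Qed.

Lemma barrier_bounds (y : 'rV[R]_m.+1) :
  r ^+ 2 <= sqnorm (y - eta) <= r ^+ 2 * (1 + e / K) ->
  0 <= barrier y <= nu / (4 * r) * (sqnorm (y - eta) - r ^+ 2).
Proof.
move=> /tau_in /profile[_ _ /andP[G0 Gle]].
have c0 : 0 <= r / (4 * K) by rewrite divr_ge0 ?mulr_ge0 ?ltW.
rewrite /barrier /psi mulr_ge0//=.
apply: le_trans (ler_wpM2l c0 Gle) _; rewrite tauE le_eqVlt; apply/orP; left.
by apply/eqP; field; rewrite r_neq0 K_neq0.
Qed.

Lemma barrier_top (y : 'rV[R]_m.+1) :
  sqnorm (y - eta) = r ^+ 2 * (1 + e / K) ->
  barrier y = r / (4 * K) * G e.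
Proof.
move=> yE; rewrite /barrier /psi yE; congr (_ * G _).
by rewrite /tau; field; rewrite r_neq0 K_neq0.
Qed.

Lemma C2_barrier (U : set 'rV[R]_m.+1) : C2 U barrier.
Proof. exact: (C2_radial _ _ _ _ _ _ dpsi dpsi1 cpsi2). Qed.

Lemma barrier_strict_supersolution (F : 'rV[R]_m.+1 -> R -> 'rV[R]_m.+1 -> 'M[R]_m.+1 -> R)
    (y : 'rV[R]_m.+1) :
  (forall (x p : 'rV[R]_m.+1) (X : 'M[R]_m.+1), symmetric_mx X ->
     - F x 0 p X <= phi (enorm p) - pucci_minus lam Lam X) ->
  r ^+ 2 <= sqnorm (y - eta) <= r ^+ 2 * (1 + e / K) ->
  symmetric_mx (hess barrier y) /\ 0 < F y 0 (grad barrier y) (hess barrier y).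
Proof.
move=> hF; set s := sqnorm _ => /andP[s_ge s_le].
rewrite /barrier (grad_radial _ _ _ _ _ dpsi) (hess_radial _ _ _ _ _ _ dpsi dpsi1).
rewrite -/s.
have sym : symmetric_mx ((2 * psi1 s)%:M + (4 * psi2 s) *: ((y - eta)^T *m (y - eta))).
  by rewrite /symmetric_mx linearD linearZ /= trmx_mul trmxK tr_scalar_mx.
split => //; rewrite -oppr_lt0; apply: le_lt_trans (hF _ _ _ sym) _.
have r2 : 0 < r ^+ 2 by rewrite exprn_gt0.
have t_in : 0 <= tau s <= e by apply: tau_in; rewrite s_ge.
have [/andP[g0 gnu] hE _] := profile _ t_in.
set q := g (tau s) in g0 gnu hE *.
(* This makes [phi q] a common unit for the gradient term and for all the eigenvalues. *)
have qphi : q <= phi q by apply: phi_ge_id; exact: ltW.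
have phi0 : 0 < phi q by exact: lt_le_trans qphi.
(* From [e <= 1 <= K], the factor [1 + e / K] is at most 2. *)
have s4 : s <= 4 * r ^+ 2.
  apply: (le_trans s_le); rewrite mulrC ler_pM2r//.
  have : e / K <= 1 by rewrite ler_pdivrMr// mul1r (le_trans e_le1).
  by lra.
have zle : enorm (y - eta) <= 2 * r.
  rewrite -(@ler_pXn2r _ 2)// ?nnegrE ?enorm_ge0 ?mulr_ge0 ?(ltW r_gt0)//.
  by rewrite enorm_sqnorm exprMn -natrX.
have psi1E : 2 * psi1 s = q / (2 * r) by rewrite /psi1 -/q; field; rewrite r_neq0.
have psi2E : 4 * psi2 s = - (K / r ^+ 3 * phi q).
  by rewrite /psi2 hE; field; rewrite r_neq0.
have gradle : phi (enorm ((2 * psi1 s) *: (y - eta))) <= phi q.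
  have : enorm ((2 * psi1 s) *: (y - eta)) <= q.
    rewrite psi1E enormZ ger0_norm; last first.
      by rewrite divr_ge0 ?mulr_ge0 ?(ltW g0) ?(ltW r_gt0).
    apply: (@le_trans _ _ (q / (2 * r) * (2 * r))).
      by rewrite ler_wpM2l// divr_ge0 ?mulr_ge0 ?(ltW g0) ?(ltW r_gt0).
    by rewrite divfK// mulf_neq0 ?pnatr_eq0.
  rewrite le_eqVlt => /predU1P[->//|lt]; apply/ltW/phi_incr => //.
  exact: enorm_ge0.
(* The negative part gains from [s >= r ^+ 2], while the positive part is at most [phi q / r]. *)
have radial_le : 2 * psi1 s + 4 * psi2 s * s <= (1 - K) * phi q / r.
  rewrite psi1E psi2E mulNr.
  have : q / (2 * r) <= phi q / r.
    rewrite ler_pdivrMr ?mulr_gt0// (_ : phi q / r * (2 * r) = phi q + phi q).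
      by rewrite (le_trans qphi)// lerDl ltW.
    by field; rewrite r_neq0.
  have : K * phi q / r <= K / r ^+ 3 * phi q * s.
    rewrite (_ : K * phi q / r = K / r ^+ 3 * phi q * r ^+ 2).
      rewrite ler_wpM2l// mulr_ge0 ?(ltW phi0)// divr_ge0 ?(ltW K_gt0)//.
      by rewrite exprn_ge0// ltW.
    by field; rewrite r_neq0.
  by rewrite mulrBl mul1r mulrBl; lra.
(* This makes the radial eigenvalue negative, as the formula for the Pucci operator requires. *)
have K1 : 1 < K.
  rewrite -(@ltr_pM2l _ lam)// mulr1 (le_lt_trans _ lamK_gt)//.
  by rewrite lerDr addr_ge0 ?mulr_ge0 ?(ltW r_gt0) ?(ltW Lam_gt0).
rewrite pucci_minus_scalar_add_rank1; last 2 first.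
- by rewrite psi1E divr_ge0 ?mulr_ge0 ?(ltW g0) ?(ltW r_gt0).
- apply: le_lt_trans radial_le _.
  by rewrite pmulr_llt0 ?invr_gt0// pmulr_llt0// subr_lt0.
rewrite -/(sqnorm (y - eta)) -/s.
rewrite psi1E in gradle radial_le *.
have trle : q / (2 * r) *+ m <= m%:R * phi q / r.
  rewrite -mulr_natl -mulrA ler_wpM2l//.
  rewrite ler_pdivrMr ?mulr_gt0// (_ : phi q / r * (2 * r) = phi q + phi q).
    by rewrite (le_trans qphi)// lerDl ltW.
  by field; rewrite r_neq0.
have lam_rad := ler_wpM2l (ltW lam_gt0) radial_le.
have Lam_tr := ler_wpM2l (ltW Lam_gt0) trle.
(* Factoring out [phi q / r] leaves exactly the quantity whose sign [lamK_gt] prescribes. *)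
have key : phi q + Lam * (m%:R * phi q / r) + lam * ((1 - K) * phi q / r) < 0.
  rewrite (_ : _ + _ = (r + Lam * m%:R + lam - lam * K) * (phi q / r)).
    by rewrite pmulr_llt0 ?divr_gt0// subr_lt0.
  by field; rewrite r_neq0.
lra.
Qed.

(** A maximum point of [u - barrier] over the compact set [A] has three possible places. On the
    boundary of [Omega], [u] vanishes; on the outer sphere the barrier dominates by [u_le];
    elsewhere the barrier is a test function whose strict inequality contradicts that of the
    subsolution. *)
Lemma barrier_comparison
    (F : 'rV[R]_m.+1 -> R -> 'rV[R]_m.+1 -> 'M[R]_m.+1 -> R)
    (Omega D : set 'rV[R]_m.+1) (u : 'rV[R]_m.+1 -> R) :
  degenerate_elliptic F ->
  (forall (x p : 'rV[R]_m.+1) (X : 'M[R]_m.+1), symmetric_mx X ->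
     - F x 0 p X <= phi (enorm p) - pucci_minus lam Lam X) ->
  open Omega ->
  (forall y, Omega y -> r ^+ 2 <= sqnorm (y - eta)) ->
  (forall y, sqnorm (y - eta) <= r ^+ 2 * (1 + e / K) -> D y) ->
  viscosity_subsolution F (Omega `&` D) u ->
  (forall x, (Omega `&` D) x -> 0 < u x) ->
  usc_on (closure Omega `&` D) u ->
  (forall x, (boundary Omega `&` D) x -> u x = 0) ->
  (forall x, (Omega `&` D) x -> u x <= r / (4 * K) * G e) ->
  forall x, Omega x -> sqnorm (x - eta) <= r ^+ 2 * (1 + e / K) ->
  u x <= barrier x.
Proof.
move=> ellF hF oO O_out inD [_ sub] u_gt0 usc_u u0 u_le x Ox xle.
have cb (y : 'rV[R]_m.+1) : {for y, continuous barrier}.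
  by have [] := C2_barrier setT y I.
pose S := [set y | sqnorm (y - eta) <= r ^+ 2 * (1 + e / K)].
pose A := closure Omega `&` S.
have A_out y : closure Omega y -> r ^+ 2 <= sqnorm (y - eta).
  move=> /(closure_subset O_out).
  by rewrite -(closure_id _).1//; exact: closed_sqdist_ge.
have usc_diff : usc_on A (fun y => u y - barrier y).
  move=> y [cly Sy] a; rewrite ltrBlDr => lt_a.
  pose d := (a + barrier y - u y) / 2.
  have d0 : 0 < d by rewrite divr_gt0// subr_gt0.
  have near_u : \forall z \near within A (nbhs y), u z < u y + d.
    have /(usc_u y) : (closure Omega `&` D) y by split => //; exact: inD.
    move=> /(_ (u y + d)); rewrite ltrDl => /(_ d0).
    rewrite !near_withinE.
    by apply: filterS => z uz [clz Sz]; apply: uz; split => //; exact: inD.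
  have near_b : \forall z \near within A (nbhs y), barrier y - d < barrier z.
    apply: cvg_within; apply: (cvgr_gt (barrier y) (cb y)).
    by rewrite ltrBlDr ltrDl.
  by apply: filterS2 near_u near_b => z; rewrite /d; lra.
have cA : compact A by apply: compact_closed_sqdist_le; exact: closed_closure.
have clO : Omega `<=` closure Omega by exact: subset_closure.
have Ax : A x by split => //; exact: clO.
have [x0 [clx0 Sx0] x0max] := usc_compact_max _ _ _ _ cA (ex_intro _ x Ax) usc_diff.
suff : u x0 <= barrier x0.
  by rewrite -subr_le0 -[u x <= _]subr_le0; apply: le_trans; exact: x0max.
have x0_in : r ^+ 2 <= sqnorm (x0 - eta) <= r ^+ 2 * (1 + e / K).
  by rewrite A_out.
have [Ox0|nOx0] := pselect (Omega x0); last first.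
  rewrite u0; first by have /andP[] := barrier_bounds _ x0_in.
  by split; [split => //; rewrite (interior_id _).1|exact: inD].
have Ux0 : (Omega `&` D) x0 by split => //; exact: inD.
have [x0top|x0lt] := eqVneq (sqnorm (x0 - eta)) (r ^+ 2 * (1 + e / K)).
  by rewrite (barrier_top _ x0top); exact: u_le.
have [sym Fgt0] := barrier_strict_supersolution _ _ hF x0_in.
have lmax : local_max_in (Omega `&` D) (fun y => u y - barrier y) x0.
  split => //.
  (* Staying strictly inside the outer sphere is an open condition, so the maximum over [A] is a
     local one in [Omega]. *)
  have : \forall y \near nbhs x0, sqnorm (y - eta) < r ^+ 2 * (1 + e / K).
    apply: (cvgr_lt _ (continuous_sqdist _ _ eta x0)).
    by rewrite lt_neqAle x0lt; exact: Sx0.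
  rewrite near_withinE.
  by apply: filterS => y /ltW yS [Oy _]; apply: x0max; split => //; exact: clO.
have := sub _ (C2_barrier _) _ lmax; rewrite leNgt => /negP[].
(* Monotonicity in the second argument carries strictness from the value 0 to the positive value
   [u x0]. *)
apply: lt_le_trans Fgt0 _; apply: ellF => //; first exact/ltW/u_gt0.
by move=> v; rewrite subrr mulmx0 mul0mx mxE.
Qed.

End Barrier.

(** * Choice of the constants and the boundary estimate *)

(** The time [e] is fixed first, then [nu] is taken large; both are chosen from [phi] and [B]
    alone. *)
Lemma decay_solution_large_integral (R : realType) (phi : R -> R) (B : R) :
  divergent_decay phi ->
  exists (e nu : R) (f : R -> R), [/\ 0 < e <= 1, decay_solution phi nu e f &
    B < \int[lebesgue_measure]_(t in `[0, e]) f t].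
Proof.
move=> [f nearf].
have [e [[e0 e1] [dec div]]] := filter_ex
  (filterI (filterI (nbhs_right_gt (0 : R)) (nbhs_right_lt ltr01)) nearf).
have [nu [dnu Bnu]] := filter_ex (filterI dec ((cvgryPgt _).1 div B)).
by exists e, nu, (f nu); split => //; rewrite e0 ltW.
Qed.

Theorem theorem3 (R : realType) (n : nat) (n_gt0 : (0 < n)%N)
    (lam Lam : R) (lam_gt0 : 0 < lam) (lam_le_Lam : lam <= Lam)
    (phi : R -> R)
    (phi_ge0 : forall t : R, 0 <= t -> 0 <= phi t)
    (phi_incr : forall s t : R, 0 <= s -> s < t -> phi s < phi t)
    (phi_cont : {within `[0, +oo[, continuous phi})
    (phi_ge_id : forall t : R, 0 <= t -> t <= phi t)
    (phi_div : divergent_decay phi)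
    (re : R) (re_gt0 : 0 < re) (M : R) :
  exists c : R, 1 <= c /\
    forall (F : 'rV[R]_n -> R -> 'rV[R]_n -> 'M[R]_n -> R),
      degenerate_elliptic F ->
      (forall (x p : 'rV[R]_n) (X : 'M[R]_n), symmetric_mx X ->
         - F x 0 p X <= phi (enorm p) - pucci_minus lam Lam X) ->
    forall (Omega : set 'rV[R]_n),
      domain Omega ->
      exterior_ball Omega re ->
    forall (w : 'rV[R]_n) (r : R),
      boundary Omega w ->
      0 < 2 * r -> 2 * r < re ->
    forall (u : 'rV[R]_n -> R),
      viscosity_subsolution F (Omega `&` eball w (6 * r)) u ->
      (forall x, (Omega `&` eball w (6 * r)) x -> 0 < u x) ->
      usc_on (closure Omega `&` eball w (6 * r)) u ->
      (forall x, (boundary Omega `&` eball w (6 * r)) x -> u x = 0) ->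
      has_ubound [set u x | x in eball w (6 * r) `&` Omega] ->
      r^-1 * sup [set u x | x in eball w (6 * r) `&` Omega] = M ->
    forall x : 'rV[R]_n, (Omega `&` eball w r) x ->
      u x <= c * set_dist x (boundary Omega).
Proof.
case: n n_gt0 => // m _.
(* Using [re] in place of [r] frees [K] from [r]; [r < re] then gives the strict inequality required
   of [K]. [M1] dominates [M] and is positive whatever the sign of [M]. *)
pose K := 1 + (re + Lam * m%:R) / lam; pose M1 := `|M| + 1.
have Lam_gt0 : 0 < Lam by exact: lt_le_trans lam_le_Lam.
have q_gt0 : 0 < (re + Lam * m%:R) / lam.
  by rewrite divr_gt0// ltr_wpDr// mulr_ge0// ltW.
have K_ge1 : 1 <= K by rewrite lerDl ltW.
have K_gt0 : 0 < K by exact: lt_le_trans K_ge1.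
have M1_gt0 : 0 < M1 by rewrite ltr_wpDl.
have lamK : lam * K = re + Lam * m%:R + lam.
  by rewrite /K; field; rewrite gt_eqF.
(* The target [4 * K * M1] cancels the factor [r / (4 * K)] of the barrier, whose value on the outer
   sphere becomes [M1 * r]. *)
have [e0 [nu [f [/andP[e0_gt0 e0_le1] dec Bint]]]] :=
  decay_solution_large_integral _ _ (4 * K * M1) phi_div.
have B_gt0 : 0 < 4 * K * M1 by rewrite !mulr_gt0.
have a_lt0 : - K - 1 < 0 by rewrite subr_lt0 (lt_trans _ ltr01)// oppr_lt0.
have [e [G [g [h [/andP[e_gt0 e_le] dGg ch [_ Ge] prof]]]]] :=
  barrier_profile _ _ phi_ge0 phi_cont _ _ _ _ _ dec e0_gt0 B_gt0 a_lt0 Bint.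
have e_le1 : e <= 1 := le_trans e_le e0_le1.
have nu_ge0 : 0 <= nu.
  have [|/andP[g0 gnu] _ _] := prof 0; first by rewrite lexx ltW.
  exact: ltW (lt_le_trans g0 gnu).
(* [nu] serves the points in the shell where the barrier works, and the last term those beyond
   it. *)
exists (Num.max 1 (Num.max nu (3 * K * M1 / e))); split.
  by rewrite le_max lexx.
set c := Num.max _ _.
have c_nu : nu <= c by rewrite !le_max lexx orbT.
have c_M : 3 * K * M1 / e <= c by rewrite !le_max lexx !orbT.
have c_ge0 : 0 <= c by exact: le_trans c_nu.
move=> F ellF hF Omega [oO _] ext w r bw r2_gt0 r2_lt u sub u_gt0 usc_u u0 ubu supu.
have r_gt0 : 0 < r by lra.
move=> x [Ox xw].
have u_le y : (Omega `&` eball w (6 * r)) y -> u y <= M1 * r.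
  move=> [Oy yw]; apply: (@le_trans _ _ (M * r)); last first.
    by rewrite ler_wpM2r ?(ltW r_gt0)// (le_trans (ler_norm _))// lerDl.
  rewrite -supu mulrAC mulVf ?gt_eqF// mul1r.
  by apply: ub_le_sup => //; exists y.
have xw' : enorm (x - w) < r := xw.
have near_bound w' : boundary Omega w' -> enorm (x - w') < r ->
    u x <= c * enorm (x - w').
  move=> bw' d_lt; set d := enorm (x - w') in d_lt *.
  have d_ge0 : 0 <= d by exact: enorm_ge0.
  have [|eta w'eta O_out] := exterior_ball_shrink _ _ _ _ _ _ ext bw' r_gt0.
    by lra.
  have O_out2 y : Omega y -> r ^+ 2 <= sqnorm (y - eta).
    move=> /O_out ry; rewrite -enorm_sqnorm ler_pXn2r ?nnegrE ?enorm_ge0//.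
    exact: ltW.
  (* Going from [y] to [w] through [eta], [w'] and [x] costs at most [2 * r], then [r], and twice
     less than [r]. *)
  have inD y : sqnorm (y - eta) <= r ^+ 2 * (1 + e / K) ->
      eball w (6 * r) y.
    move=> yle; have yeta : enorm (y - eta) <= 2 * r.
      rewrite -(@ler_pXn2r _ 2)// ?nnegrE ?enorm_ge0 ?(ltW r2_gt0)//.
      rewrite enorm_sqnorm exprMn mulrC (le_trans yle)// ler_pM2l ?exprn_gt0//.
      have : e / K <= 1 by rewrite ler_pdivrMr// mul1r (le_trans e_le1).
      by rewrite -natrX; lra.
    rewrite /eball /= (_ : y - w = ((y - eta) + (eta - w')) + ((w' - x) + (x - w))).
      have := enormD _ _ (y - eta + (eta - w')) (w' - x + (x - w)).
      have := enormD _ _ (y - eta) (eta - w').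
      have := enormD _ _ (w' - x) (x - w).
      by rewrite (enormB _ _ eta) w'eta (enormB _ _ w') -/d; lra.
    by apply/rowP => i; rewrite !mxE; ring.
  (* With [d < r], [(d + r)^2 - r^2 = d^2 + 2 r d] is at most [3 r d]. *)
  have sq_le : sqnorm (x - eta) - r ^+ 2 <= 3 * r * d.
    have xeta : enorm (x - eta) <= d + r.
      rewrite -w'eta (_ : x - eta = (x - w') + (w' - eta)) ?enormD//.
      by rewrite addrA subrK.
    rewrite -enorm_sqnorm; have := enorm_ge0 _ _ (x - eta); nra.
  have Ux : (Omega `&` eball w (6 * r)) x.
    by split => //; rewrite /eball /=; lra.
  (* In the shell the barrier is at most [3 / 4 * (nu * d)]. Beyond it, [sq_le] forces
     [d > e r / (3 K)], so the crude bound [M1 * r] is already linear in [d]. *)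
  have [xin|xout] := leP (sqnorm (x - eta)) (r ^+ 2 * (1 + e / K)).
    have lamK_gt : r + Lam * m%:R + lam < lam * K by rewrite lamK; lra.
    have topE : r / (4 * K) * G e = M1 * r.
      by rewrite Ge; field; rewrite gt_eqF.
    have := barrier_comparison _ _ _ _ _ lam_gt0 Lam_gt0 phi_incr phi_ge_id
      _ _ r_gt0 K_ge1 lamK_gt _ _ _ _ _ e_le1 dGg ch prof eta F Omega
      (eball w (6 * r)) u ellF hF oO O_out2 inD sub u_gt0 usc_u u0.
    rewrite topE => /(_ u_le x Ox xin) /le_trans; apply.
    have /andP[_] := barrier_bounds _ _ _ _ _ r_gt0 K_ge1 _ _ _ _ _ prof eta x
      (introT andP (conj (O_out2 _ Ox) xin)).
    move=> /le_trans; apply.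
    apply: (@le_trans _ _ (nu / (4 * r) * (3 * r * d))).
      by rewrite ler_wpM2l// divr_ge0// mulr_ge0// ltW.
    rewrite (_ : _ * _ = 3 / 4 * (nu * d)); last by field; rewrite gt_eqF.
    apply: (@le_trans _ _ (nu * d)); last by rewrite ler_wpM2r.
    have := mulr_ge0 nu_ge0 d_ge0; lra.
  apply: le_trans (u_le x Ux) _.
  apply: (@le_trans _ _ (3 * K * M1 / e * d)); last by rewrite ler_wpM2r.
  have : r ^+ 2 * (e / K) < 3 * r * d.
    by apply: lt_le_trans sq_le; rewrite ltrBrDl; move: xout; rewrite mulrDr mulr1.
  rewrite expr2 -mulrA (mulrC 3) -(mulrA r 3) ltr_pM2l// mulrA ltr_pdivrMr//.
  rewrite -ltr_pdivlMr// => /ltW/(ler_wpM2l (ltW M1_gt0))/le_trans; apply.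
  by rewrite le_eqVlt; apply/orP; left; apply/eqP; field; rewrite gt_eqF.
(* A boundary point at distance at least [r] is farther from [x] than [w] is, so the estimate at [w]
   suffices. *)
have bound w' : boundary Omega w' -> u x <= c * enorm (x - w').
  move=> bw'; have [rd|dr] := leP r (enorm (x - w')); last exact: near_bound.
  apply: le_trans (near_bound w bw xw') _.
  by rewrite ler_wpM2l// (le_trans (ltW xw')).
have c_gt0 : 0 < c by rewrite lt_max ltr01.
rewrite -ler_pdivrMl// /set_dist; apply: lb_le_inf.
  (* The point [w] makes the set of distances nonempty, so its infimum is a genuine one. *)
  by exists (enorm (x - w)), w.
by move=> _ [w' bw' <-]; rewrite ler_pdivrMl//; exact: bound.
Qed.
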